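(* Let $\Phi=\{\phi_1,\dots,\phi_n\}\subset L^\infty(X)$ with synthesis operator $\mathcal Tc=\sum_{i=1}^n c_i\phi_i$, and let $\mathcal M:L^\infty(X)\to\mathbb C^m$ be a sampling operator satisfying $$\gamma\left(\|\mathcal Tc\|_{L^2_\rho}+\epsilon\|c\|_2\right)\le\|\mathcal Tc\|_{\mathcal M}+\epsilon\|c\|_2,\qquad\forall c\in\mathbb C^n,$$ for some $0<\gamma\le1$ and $\epsilon\ge u\sqrt n\,\|\mathcal T\|_{2,L^2_\rho}$. Given $f\in L^\infty(X)$, let $$E_\epsilon(c)=\|\mathcal Tc-f\|_{L^2_\rho}+\epsilon\|c\|_2,\qquad e_\epsilon(c)=\|\mathcal Tc-f\|_{\mathcal M}+\epsilon\|c\|_2,$$ and let $\hat c\in\mathbb C^n$ satisfy $e_\epsilon(\hat c)\le C\inf_{c\in\mathbb C^n}e_\epsilon(c)$ for some $C\ge1$. Then $$\|\mathrm{fl}(\mathcal T)\hat c-\mathrm{fl}(f)\|_{L^2_\rho}\le\inf_{c\in\mathbb C^n}\left(E_\epsilon(c)+\frac{1+C}{\gamma}e_\epsilon(c)\right)+u\|f\|_{L^2_\rho}$$ $$\le\inf_{c\in\mathbb C^n}\left(\left(1+\|\mathcal M\|_{L^\infty,2}\frac{1+C}{\gamma}\right)\|\mathcal Tc-f\|_{L^\infty}+\left(1+\frac{1+C}{\gamma}\right)\epsilon\|c\|_2\right)+u\|f\|_{L^2_\rho}.$$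
   Context: $X\subseteq\mathbb R^d$ is measurable, $\rho$ is a non-atomic probability measure on $X$ (so $\rho(X)=1$), and $\|\cdot\|_{L^2_\rho}$ is the norm of the complex space $L^2(X,\rho)$. $\|\mathcal T\|_{2,L^2_\rho}=\sup_{c\ne0}\|\mathcal Tc\|_{L^2_\rho}/\|c\|_2$. No linear independence of $\Phi$ is assumed. A sampling operator $\mathcal M:L^\infty(X)\to\mathbb C^m$, $f\mapsto\{l_j(f)\}_{j=1}^m$, consists of $m$ linear functionals and is assumed bounded: $\|\mathcal M\|_{L^\infty,2}=\sup_{v\ne0}\|\mathcal Mv\|_2/\|v\|_{L^\infty}<\infty$. It defines the seminorm $\|v\|_{\mathcal M}=\|\mathcal Mv\|_2$. $\mathrm{fl}:\mathbb C\to\mathbb C$ is a (measurable) rounding map with unit roundoff $u>0$: for every $y\in\mathbb C$ there is $\delta\in\mathbb C$ with $|\delta|\le u$ and $\mathrm{fl}(y)=y(1+\delta)$. For a function $v$, $\mathrm{fl}(v)=\mathrm{fl}\circ v$; and $\mathrm{fl}(\mathcal T)c=\sum_{i=1}^n c_i\,\mathrm{fl}(\phi_i)$. *)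

(* Defs.v *)
From HB Require Import structures.
From mathcomp Require Import all_boot all_order all_algebra.
From mathcomp Require Import all_classical all_reals all_analysis.
From mathcomp Require Import complex.

Set Implicit Arguments.
Unset Strict Implicit.
Unset Printing Implicit Defensive.

Import Order.TTheory GRing.Theory Num.Theory.

Local Open Scope classical_set_scope.
Local Open Scope ring_scope.
Local Open Scope complex_scope.

(* A nonempty subset X of a measurable space, as a measurable space with the
   trace sigma-algebra. Nonemptiness is required only because measurable types
   are pointed; it is implied by the existence of a probability measure on X. *)
Definition nonempty_sub (T : choiceType) (X : set T) (X0 : X !=set0) : Type :=
  {x : T | x \in X}.

Section nonempty_sub.
Context (T : choiceType) (X : set T) (X0 : X !=set0).

HB.instance Definition _ :=
  Choice.copy (nonempty_sub X0) {x : T | x \in X}.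

HB.instance Definition _ := isPointed.Build (nonempty_sub X0)
  (exist _ (sval (cid X0)) (mem_set (svalP (cid X0)))).

Definition nonempty_val : nonempty_sub X0 -> T := fun x => sval x.

End nonempty_sub.

Arguments nonempty_val {T X} X0 _.

Notation submeasurable X0 := (g_sigma_algebra_preimageType (nonempty_val X0)).

Notation normc := ComplexField.Normc.normc.

Definition norm2 (R : rcfType) (n : nat) (c : 'cV[R[i]]_n) : R :=
  Num.sqrt (\sum_(i < n) normc (c i ord0) ^+ 2).

Section operators.
Context (R : rcfType) (T : Type) (n m : nat).
Variables (phi : 'I_n -> T -> R[i]) (l : 'I_m -> (T -> R[i]) -> R[i]).

Definition synthesis (c : 'cV[R[i]]_n) : T -> R[i] :=
  fun x => \sum_(i < n) c i ord0 * phi i x.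

Definition residual (f : T -> R[i]) (c : 'cV[R[i]]_n) : T -> R[i] :=
  fun x => synthesis c x - f x.

Definition sampling (v : T -> R[i]) : 'cV[R[i]]_m := \col_(j < m) l j v.

Definition Mnorm (v : T -> R[i]) : R := norm2 (sampling v).

Definition sampled_error (f : T -> R[i]) (eps : R) (c : 'cV[R[i]]_n) : \bar R :=
  (Mnorm (residual f c) + eps * norm2 c)%:E.

End operators.

Definition cmeasurable (R : realType) d (T : measurableType d)
    (v : T -> R[i]) : Prop :=
  measurable_fun setT (fun x => complex.Re (v x)) /\
  measurable_fun setT (fun x => complex.Im (v x)).

Section spaces.
Context (R : realType) d (T : measurableType d).
Variable rho : {measure set T -> \bar R}.
Implicit Types v w f : T -> R[i].

Definition nonatomic : Prop :=
  forall A, measurable A -> (0 < rho A)%E ->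
  exists B, [/\ measurable B, B `<=` A, (0 < rho B)%E & (rho B < rho A)%E].

Definition L2norm v : \bar R := Lnorm rho 2%:E (fun x => (normc (v x))%:E).

Definition Linfnorm v : \bar R := Lnorm rho +oo%E (fun x => (normc (v x))%:E).

(* L^oo is taken with respect to rho, and its elements are represented by
   functions, equality in L^oo being equality rho-almost everywhere. *)
Definition Linfty v : Prop := cmeasurable v /\ (Linfnorm v < +oo)%E.

(* The first clause says that l is well defined on classes; nothing is said
   about the value of l at a function outside L^oo. *)
Definition Linfty_linear (l : (T -> R[i]) -> R[i]) : Prop :=
  (forall v w, Linfty v -> Linfty w -> v = w %[ae rho] -> l v = l w) /\
  (forall a v w, Linfty v -> Linfty w ->
     l (fun x => a * v x + w x) = a * l v + l w).

Definition synthesis_norm (n : nat) (phi : 'I_n -> T -> R[i]) : \bar R :=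
  ereal_sup [set (L2norm (synthesis phi c) / (norm2 c)%:E)%E |
             c in [set c | c != 0]].

Definition sampling_norm (m : nat) (l : 'I_m -> (T -> R[i]) -> R[i]) :
    \bar R :=
  ereal_sup [set ((norm2 (sampling l v))%:E / Linfnorm v)%E |
             v in [set v | Linfty v /\ ~ (v = (fun=> 0) %[ae rho])]].

Definition L2error (n : nat) (phi : 'I_n -> T -> R[i]) f (eps : R)
    (c : 'cV[R[i]]_n) : \bar R :=
  (L2norm (residual phi f c) + (eps * norm2 c)%:E)%E.

End spaces.

(* Measurability of fl is with respect to the Borel sigma-algebra of C = R^2. *)
Definition rounding (R : realType) (u : R) (fl : R[i] -> R[i]) : Prop :=
  cmeasurable (fun p : R * R => fl (p.1 +i* p.2)) /\
  (forall y, exists2 delta : R[i], normc delta <= u & fl y = y * (1 + delta)).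

(* Main.v *)
Require Import Defs.
From mathcomp Require Import all_boot all_order all_algebra.
From mathcomp Require Import all_classical all_reals all_analysis.
From mathcomp Require Import measurable_realfun ess_sup_inf complex ring lra.

Import Order.TTheory GRing.Theory Num.Theory.

Local Open Scope classical_set_scope.
Local Open Scope ring_scope.
Local Open Scope complex_scope.

Set Implicit Arguments.
Unset Strict Implicit.
Unset Printing Implicit Defensive.

(** The first inequality combines two independent estimates.

    Rounding.  Since fl (phi i) - phi i is at most u |phi i| pointwise, the
    synthesis operator built from the rounded functions differs from the exact
    one at c by at most u \sum_i |c_i| ||phi i||, in the L2 norm.  Each
    ||phi i|| is at most ||T||, as phi i = T e_i, and
    \sum_i |c_i| <= sqrt n ||c||_2 by Cauchy-Schwarz, so the difference is at
    most u sqrt n ||T|| ||c||_2 <= eps ||c||_2: the regularisation term of E_eps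
    absorbs the rounding of the basis, and the rounding of f costs u ||f||.
    This is [rounded_error], valid at every c.

    Near-optimality.  By the triangle inequality E_eps (hc) exceeds E_eps (c) by
    at most ||T (hc - c)|| + eps ||hc - c||_2.  The norm inequality bounds this
    by gamma^-1 times its sampled counterpart, and linearity of the functionals
    bounds the latter by e_eps (hc) + e_eps (c) <= (1 + C) e_eps (c).  This is
    [L2error_near_minimizer].

    The second inequality compares the two infima term by term, using that on a
    probability space the L2 norm is below the essential supremum and that
    ||v||_M <= ||M|| ||v||_oo ([L2norm_Mnorm_le_Linfnorm]). *)

(** * Coefficient vectors *)

Section coefficients.
Context (R : rcfType).

Lemma normc_ge0 (z : R[i]) : 0 <= normc z.
Proof. by case: z => a b; exact: sqrtr_ge0. Qed.

(** With P the inner product and A, B the two sums of squares, the nonnegative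
    sum of the squares of [B * a i - P * b i] equals B (A B - P^2), whence
    P^2 <= A B as soon as B > 0. *)
Lemma cauchy_schwarz_sum n (a b : 'I_n -> R) :
  \sum_(i < n) a i * b i <=
  Num.sqrt (\sum_(i < n) a i ^+ 2) * Num.sqrt (\sum_(i < n) b i ^+ 2).
Proof.
set P := \sum_(i < n) _; set A := \sum_(i < n) _; set B := \sum_(i < n) _.
have A0 : 0 <= A by apply: sumr_ge0 => i _; exact: sqr_ge0.
have B0 : 0 <= B by apply: sumr_ge0 => i _; exact: sqr_ge0.
rewrite -sqrtrM// (le_trans (ler_norm _))// -sqrtr_sqr ler_sqrt ?mulr_ge0//.
have [B00|Bn0] := eqVneq B 0.
  suff -> : P = 0 by rewrite expr0n/= mulr_ge0.
  apply: big1 => i _.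
  move/eqP: B00; rewrite psumr_eq0; last by move=> j _; exact: sqr_ge0.
  by move/allP => /(_ i (mem_index_enum _)) /=; rewrite sqrf_eq0 => /eqP->; rewrite mulr0.
have Bgt0 : 0 < B by rewrite lt_def Bn0.
have : 0 <= \sum_(i < n) (B * a i - P * b i) ^+ 2.
  by apply: sumr_ge0 => i _; exact: sqr_ge0.
have -> : \sum_(i < n) (B * a i - P * b i) ^+ 2 = B * (A * B - P ^+ 2).
  transitivity (\sum_(i < n) (B ^+ 2 * a i ^+ 2 - 2 * B * P * (a i * b i)
                              + P ^+ 2 * b i ^+ 2)).
    by apply: eq_bigr => i _; ring.
  rewrite big_split/= sumrB -!mulr_sumr -/A -/B -/P; ring.
by rewrite pmulr_rge0// subr_ge0.
Qed.

Lemma norm2_ge0 n (c : 'cV[R[i]]_n) : 0 <= norm2 c.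
Proof. exact: sqrtr_ge0. Qed.

Lemma norm20 n : norm2 (0 : 'cV[R[i]]_n) = 0.
Proof.
rewrite /norm2 big1 ?sqrtr0// => i _.
by rewrite mxE ComplexField.Normc.normc0 expr0n.
Qed.

Lemma norm2_delta n (i : 'I_n) : norm2 (delta_mx i 0 : 'cV[R[i]]_n) = 1.
Proof.
rewrite /norm2 (bigD1 i)//= big1 => [|j ji]; rewrite mxE ?eqxx.
  by rewrite ComplexField.Normc.normc1 expr1n addr0 sqrtr1.
by rewrite (negbTE ji) ComplexField.Normc.normc0 expr0n.
Qed.

Lemma norm2N n (c : 'cV[R[i]]_n) : norm2 (- c) = norm2 c.
Proof. by congr Num.sqrt; apply: eq_bigr => i _; rewrite mxE normcN. Qed.

Lemma norm2D n (a b : 'cV[R[i]]_n) : norm2 (a + b) <= norm2 a + norm2 b.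
Proof.
rewrite -(@ler_pXn2r _ 2)// ?nnegrE ?addr_ge0 ?norm2_ge0//.
rewrite sqrrD !sqr_sqrtr; try by apply: sumr_ge0 => i _; exact: sqr_ge0.
apply: (@le_trans _ _
    (\sum_(i < n) (normc (a i ord0) + normc (b i ord0)) ^+ 2)).
  apply: ler_sum => i _.
  by rewrite mxE ler_pXn2r ?nnegrE ?addr_ge0 ?normc_ge0// le_normcD.
under eq_bigr do rewrite sqrrD.
rewrite !big_split/= lerD2r lerD2l mulr2n.
by apply: lerD; exact: cauchy_schwarz_sum.
Qed.

Lemma sum_normc_le n (c : 'cV[R[i]]_n) :
  \sum_(i < n) normc (c i ord0) <= Num.sqrt n%:R * norm2 c.
Proof.
have := cauchy_schwarz_sum (fun=> 1) (fun i => normc (c i ord0)).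
under eq_bigr do rewrite mul1r.
have -> // : \sum_(i < n) 1 ^+ 2 = n%:R :> R.
by under eq_bigr do rewrite expr1n; rewrite sumr_const card_ord.
Qed.

End coefficients.

(** * Linearity of the synthesis operator *)

Section synthesis_algebra.
Context (R : rcfType) (T : Type) (n : nat).
Variables (phi : 'I_n -> T -> R[i]).

Lemma synthesis_delta i : synthesis phi (delta_mx i 0) = phi i.
Proof.
apply/funext => x; rewrite /synthesis (bigD1 i)//= big1 => [|j ji].
  by rewrite mxE !eqxx mul1r addr0.
by rewrite mxE (negbTE ji) mul0r.
Qed.

Lemma synthesisB c c' :
  synthesis phi (c - c') = (fun x => synthesis phi c x - synthesis phi c' x).
Proof.
apply/funext => x; rewrite /synthesis -sumrB; apply: eq_bigr => i _.
by rewrite !mxE mulrBl.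
Qed.

End synthesis_algebra.

(** * Measurability of complex-valued functions *)

Section complex_functions.
Context (R : realType) d (T : measurableType d).
Implicit Types v w : T -> R[i].

Lemma cmeasurable_lin (a : R[i]) v w : cmeasurable v -> cmeasurable w ->
  cmeasurable (fun x => a * v x + w x).
Proof.
move=> [mv1 mv2] [mw1 mw2]; case: a => a b; split.
- rewrite (_ : (fun x => _) = (fun x => a * complex.Re (v x) - b * complex.Im (v x)
      + complex.Re (w x))).
    apply: measurable_funD => //; apply: measurable_funB;
      exact: measurable_funM.
  by apply/funext => x; case: (v x) (w x) => ? ? [? ?].
- rewrite (_ : (fun x => _) = (fun x => a * complex.Im (v x) + b * complex.Re (v x)
      + complex.Im (w x))).
    apply: measurable_funD => //; apply: measurable_funD;
      exact: measurable_funM.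
  by apply/funext => x; case: (v x) (w x) => ? ? [? ?].
Qed.

Lemma cmeasurableB v w : cmeasurable v -> cmeasurable w ->
  cmeasurable (fun x => v x - w x).
Proof.
move=> mv mw; rewrite (_ : (fun x => _) = (fun x => -1 * w x + v x)).
  exact: cmeasurable_lin.
by apply/funext => x; rewrite mulN1r addrC.
Qed.

Lemma cmeasurable0 : cmeasurable (fun _ : T => 0 : R[i]).
Proof. by split; exact: measurable_cst. Qed.

Lemma cmeasurable_sum (I : Type) (r : seq I) (a : I -> R[i]) (F : I -> T -> R[i]) :
  (forall i, cmeasurable (F i)) ->
  cmeasurable (fun x => \sum_(i <- r) a i * F i x).
Proof.
move=> mF; elim: r => [|i r IH].
  under eq_fun do rewrite big_nil.
  exact: cmeasurable0.
under eq_fun do rewrite big_cons.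
exact: cmeasurable_lin.
Qed.

Lemma measurable_normc v : cmeasurable v ->
  measurable_fun setT (fun x => normc (v x)).
Proof.
move=> [mr mi].
rewrite (_ : (fun x => _) =
  (fun x => (complex.Re (v x) ^+ 2 + complex.Im (v x) ^+ 2) `^ 2^-1)).
  (* the square root is measurable as the power of exponent 1/2 *)
  apply: (@measurableT_comp _ _ _ _ _ _ (fun r => r `^ 2^-1)).
    exact: measurable_powR.
  by apply: measurable_funD; exact: measurable_funX.
apply/funext => x; case: (v x) => a b /=.
by rewrite powR12_sqrt// addr_ge0// sqr_ge0.
Qed.

(** The measurability of a rounding map is that of a function of the real and
    imaginary parts, hence the detour through the pair of the two. *)
Lemma rounding_cmeasurable (u : R) (fl : R[i] -> R[i]) v :
  rounding u fl -> cmeasurable v -> cmeasurable (fl \o v).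
Proof.
move=> [[mr mi] _] [vr vi].
have mv : measurable_fun setT (fun x => (complex.Re (v x), complex.Im (v x))).
  exact: measurable_fun_pair.
have E (g : R[i] -> R) : (fun x => g (fl (v x))) =
    (fun p : R * R => g (fl (p.1 +i* p.2))) \o
    (fun x => (complex.Re (v x), complex.Im (v x))).
  by apply/funext => x /=; case: (v x).
by split; rewrite /= E; exact: measurableT_comp.
Qed.

End complex_functions.

Lemma rounding_error (R : realType) (u : R) (fl : R[i] -> R[i]) y :
  rounding u fl -> normc (fl y - y) <= u * normc y.
Proof.
move=> [_ /(_ y)[delta du ->]].
rewrite (_ : _ - _ = delta * y); last by ring.
by rewrite ComplexField.Normc.normcM ler_wpM2r// normc_ge0.
Qed.

(** * The L2 and L-infinity norms on a probability space *)

Section norms.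
Context (R : realType) d (T : measurableType d) (rho : probability T R).
Implicit Types v w : T -> R[i].
Local Open Scope ereal_scope.

Lemma L2norm_ge0 v : 0 <= L2norm rho v.
Proof. exact: Lnorm_ge0. Qed.

Lemma Linfnorm_ge0 v : 0 <= Linfnorm rho v.
Proof. exact: Lnorm_ge0. Qed.

Lemma ge0_le_poweR (r : R) (x y : \bar R) :
  (0 <= r)%R -> 0 <= x -> x <= y -> x `^ r <= y `^ r.
Proof.
move=> r0 x0 xy; apply: gt0_ler_poweR => //; rewrite in_itv/= leey andbT//.
exact: le_trans xy.
Qed.

Lemma measurable_abse_sqr (g : T -> R) : measurable_fun setT g ->
  measurable_fun setT (fun x => `|(g x)%:E| `^ 2).
Proof.
move=> mg; apply: (measurableT_comp (measurable_poweR 2)).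
by apply: measurableT_comp => //; exact/measurable_EFinP.
Qed.

Lemma Lnorm2_le (g h : T -> R) :
  measurable_fun setT g -> measurable_fun setT h ->
  (forall x, 0 <= g x <= h x)%R ->
  'N[rho]_2%:E [EFin \o g] <= 'N[rho]_2%:E [EFin \o h].
Proof.
move=> mg mh gh; rewrite unlock /Lnorm.
apply: ge0_le_poweR; first by rewrite invr_ge0.
  by apply: integral_ge0 => x _; exact: poweR_ge0.
apply: ge0_le_integral => //.
- by move=> x _; exact: poweR_ge0.
- exact: measurable_abse_sqr.
- exact: measurable_abse_sqr.
move=> x _; have /andP[g0 gh'] := gh x.
by apply: ge0_le_poweR => //; rewrite lee_fin !ger0_norm// (le_trans g0).
Qed.

(** Minkowski's inequality for real functions, applied to the moduli.  Stating
    it for a pointwise bound covers sums and differences at once. *)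
Lemma L2norm_le_add v w z : cmeasurable v -> cmeasurable w -> cmeasurable z ->
  (forall x, normc (v x) <= normc (w x) + normc (z x))%R ->
  L2norm rho v <= L2norm rho w + L2norm rho z.
Proof.
move=> /measurable_normc mv /measurable_normc mw /measurable_normc mz vwz.
apply: (le_trans _ (minkowski_EFin _ mw mz _)); last by rewrite ler1n.
apply: Lnorm2_le => //; first exact: measurable_funD.
by move=> x; rewrite normc_ge0 vwz.
Qed.

Lemma L2normD v w : cmeasurable v -> cmeasurable w ->
  L2norm rho (fun x => v x + w x)%R <= L2norm rho v + L2norm rho w.
Proof.
move=> mv mw; apply: L2norm_le_add => //; last by move=> x; exact: le_normcD.
rewrite (_ : (fun x => _) = (fun x => 1 * v x + w x)%R).
  exact: cmeasurable_lin.
by apply/funext => x; rewrite mul1r.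
Qed.

Lemma L2normB v w : cmeasurable v -> cmeasurable w ->
  L2norm rho (fun x => v x - w x)%R <= L2norm rho v + L2norm rho w.
Proof.
move=> mv mw; apply: L2norm_le_add => //; first exact: cmeasurableB.
by move=> x; rewrite -[normc (w x)]normcN le_normcD.
Qed.

Lemma Lnorm2Z (a : R) (g : T -> R) : (0 <= a)%R -> measurable_fun setT g ->
  'N[rho]_2%:E [(fun x => (a * g x)%:E)] = a%:E * 'N[rho]_2%:E [EFin \o g].
Proof.
move=> a0 mg; rewrite unlock /Lnorm.
under eq_integral do rewrite EFinM abseM poweRM//.
have ha : `|a%:E| = a%:E by rewrite gee0_abs.
rewrite ha ge0_integralZl//; last 3 first.
- exact: measurable_abse_sqr.
- by move=> x _; exact: poweR_ge0.
- exact: poweR_ge0.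
rewrite poweRM ?poweR_ge0//; last by apply: integral_ge0 => x _; exact: poweR_ge0.
by rewrite -poweRrM mulfV// poweRe1.
Qed.

Lemma L2norm_le_scale (a : R) v w : (0 <= a)%R -> cmeasurable v -> cmeasurable w ->
  (forall x, normc (v x) <= a * normc (w x))%R ->
  L2norm rho v <= a%:E * L2norm rho w.
Proof.
move=> a0 /measurable_normc mv /measurable_normc mw vw.
rewrite /L2norm -Lnorm2Z//; apply: Lnorm2_le => //.
  exact: measurable_funM.
by move=> x; rewrite normc_ge0 vw.
Qed.

Lemma L2norm_sum (I : Type) (r : seq I) (a : I -> R[i]) (F : I -> T -> R[i]) :
  (forall i, cmeasurable (F i)) ->
  L2norm rho (fun x => \sum_(i <- r) a i * F i x)%R
  <= \sum_(i <- r) (normc (a i))%:E * L2norm rho (F i).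
Proof.
move=> mF; elim: r => [|i r IH].
  rewrite big_nil; under eq_fun do rewrite big_nil.
  rewrite /L2norm; under eq_fun do rewrite ComplexField.Normc.normc0.
  by rewrite Lnorm0.
rewrite big_cons; under eq_fun do rewrite big_cons.
have ms := cmeasurable_sum r a mF.
have maF : cmeasurable (fun x => a i * F i x)%R.
  rewrite (_ : (fun x => _) = (fun x => a i * F i x + 0)%R).
    exact/cmeasurable_lin/cmeasurable0.
  by apply/funext => x; rewrite addr0.
apply: le_trans (L2normD maF ms) _; apply: leeD => //.
apply: L2norm_le_scale => //; first exact: normc_ge0.
by move=> x; rewrite ComplexField.Normc.normcM.
Qed.

Lemma LinfnormE v : Linfnorm rho v = ess_sup rho (fun x => (normc (v x))%:E).
Proof.
rewrite /Linfnorm unlock /Lnorm ifT; last first.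
  by rewrite (_ : _ setT = 1) ?lte01//; exact: probability_setT.
by apply: eq_ess_sup; apply: nearW => x /=; rewrite ger0_norm ?normc_ge0.
Qed.

Lemma ae_le_Linfnorm v : {ae rho, forall x, (normc (v x))%:E <= Linfnorm rho v}.
Proof.
rewrite LinfnormE; exact: ess_sup_ge.
Qed.

Lemma Linfnorm_le v M :
  {ae rho, forall x, (normc (v x))%:E <= M} -> Linfnorm rho v <= M.
Proof. by rewrite LinfnormE => vM; exact/ess_supP. Qed.

Lemma Linfnorm_ae0 v : v = (fun=> 0%R) %[ae rho] -> Linfnorm rho v = 0.
Proof.
move=> v0; apply/eqP; rewrite eq_le Linfnorm_ge0 andbT; apply: Linfnorm_le.
by apply: filterS v0 => x /= ->; rewrite ?ComplexField.Normc.normc0.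
Qed.

Lemma Linfnorm_eq0 v : Linfnorm rho v = 0 -> v = (fun=> 0%R) %[ae rho].
Proof.
move=> v0; apply: filterS (ae_le_Linfnorm v) => x + _.
rewrite v0 lee_fin => vx; apply: ComplexField.Normc.eq0_normc.
by apply/eqP; rewrite eq_le vx normc_ge0.
Qed.

Lemma Linfty_lin (a : R[i]) v w : Linfty rho v -> Linfty rho w ->
  Linfty rho (fun x => a * v x + w x)%R.
Proof.
move=> [mv voo] [mw woo]; split; first exact: cmeasurable_lin.
apply: (@le_lt_trans _ _ ((normc a)%:E * Linfnorm rho v + Linfnorm rho w)).
  apply: Linfnorm_le.
  apply: filterS2 (ae_le_Linfnorm v) (ae_le_Linfnorm w) => x vx wx.
  apply: (@le_trans _ _ ((normc a)%:E * (normc (v x))%:E + (normc (w x))%:E)).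
    rewrite -EFinM -EFinD lee_fin (le_trans (le_normcD _ _))//.
    by rewrite ComplexField.Normc.normcM.
  by apply: leeD => //; apply: lee_wpmul2l => //; rewrite lee_fin normc_ge0.
rewrite lte_add_pinfty// lte_mul_pinfty// lee_fin; exact: normc_ge0.
Qed.

Lemma Linfty0 : Linfty rho (fun=> 0%R).
Proof.
split; first exact: cmeasurable0.
apply: le_lt_trans (ltry 0); apply: Linfnorm_le; apply: nearW => x.
by rewrite ComplexField.Normc.normc0.
Qed.

Lemma LinftyB v w : Linfty rho v -> Linfty rho w ->
  Linfty rho (fun x => v x - w x)%R.
Proof.
move=> Lv Lw; rewrite (_ : (fun x => _) = (fun x => -1 * w x + v x)%R).
  exact: Linfty_lin.
by apply/funext => x; rewrite mulN1r addrC.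
Qed.

Lemma Linfty_synthesis n (phi : 'I_n -> T -> R[i]) c :
  (forall i, Linfty rho (phi i)) -> Linfty rho (synthesis phi c).
Proof.
move=> Lphi; rewrite /synthesis; elim: (index_enum _) => [|i r IH].
  under eq_fun do rewrite big_nil.
  exact: Linfty0.
under eq_fun do rewrite big_cons.
exact: Linfty_lin.
Qed.

(** Off a null set |v| is at most M, the essential supremum, and the constant
    function [M `^ 2] integrates to [M `^ 2] because the total mass is 1. *)
Lemma L2norm_le_Linfnorm v : cmeasurable v -> L2norm rho v <= Linfnorm rho v.
Proof.
move=> /measurable_normc mv.
have [M0 vM] := (Linfnorm_ge0 v, ae_le_Linfnorm v).
move: (Linfnorm _ _) M0 vM => M M0 vM.
have -> : M = (M `^ 2) `^ 2^-1 by rewrite -poweRrM mulfV// poweRe1.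
rewrite /L2norm unlock /Lnorm.
apply: ge0_le_poweR; first by rewrite invr_ge0.
  by apply: integral_ge0 => x _; exact: poweR_ge0.
have -> : M `^ 2 = \int[rho]_(x in setT) cst (M `^ 2) x.
  rewrite integral_cst// [X in _ * X](_ : _ = 1) ?mule1//.
  exact: probability_setT.
apply: ae_ge0_le_integral => //.
- by move=> x _; exact: poweR_ge0.
- exact: measurable_abse_sqr.
- by move=> x _; exact: poweR_ge0.
apply: filterS vM => x vx _; apply: ge0_le_poweR => //=.
by rewrite ger0_norm ?normc_ge0.
Qed.

End norms.

(** * Sampling operators *)

Section sampling.
Context (R : realType) d (T : measurableType d) (rho : probability T R).
Context (m : nat) (l : 'I_m -> (T -> R[i]) -> R[i]).
Hypothesis l_linear : forall j, Linfty_linear rho (l j).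
Implicit Types v w : T -> R[i].

Lemma samplingB v w : Linfty rho v -> Linfty rho w ->
  sampling l (fun x => v x - w x) = sampling l v - sampling l w.
Proof.
move=> Lv Lw; apply/colP => j; rewrite !mxE.
rewrite (_ : (fun x => _) = (fun x => -1 * w x + v x)); last first.
  by apply/funext => x; rewrite mulN1r addrC.
by rewrite (l_linear j).2// mulN1r addrC.
Qed.

(** The functionals only see classes modulo almost-everywhere equality, and the
    class of v is that of 0 = 0 - 0, whose samples vanish by linearity. *)
Lemma Mnorm_ae0 v : Linfty rho v -> v = (fun=> 0) %[ae rho] -> Mnorm l v = 0.
Proof.
move=> Lv v0; rewrite /Mnorm (_ : sampling l v = 0) ?norm20//.
rewrite -(subrr (sampling l (fun=> 0))) -samplingB; [|exact: Linfty0..].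
apply/colP => j; rewrite !mxE; apply: (l_linear j).1 => //.
  by apply: LinftyB; exact: Linfty0.
by apply: filterS v0 => x /= /[apply] ->; rewrite subrr.
Qed.

Local Open Scope ereal_scope.

Lemma sampling_norm_ubound v : Linfty rho v -> ~ (v = (fun=> 0%R) %[ae rho]) ->
  (Mnorm l v)%:E / Linfnorm rho v <= sampling_norm rho l.
Proof. by move=> Lv v0; apply: ereal_sup_ubound; exists v. Qed.

(** The supremum defining the sampling norm ranges over the nonzero classes, so
    the zero class has to be treated apart. *)
Lemma Mnorm_le_Linfnorm v : Linfty rho v ->
  (Mnorm l v)%:E <= sampling_norm rho l * Linfnorm rho v.
Proof.
move=> Lv; have [v0|vn0] := pselect (v = (fun=> 0%R) %[ae rho]).
  by rewrite Linfnorm_ae0// Mnorm_ae0// mule0.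
have := sampling_norm_ubound Lv vn0.
have := Lv.2; have := Linfnorm_ge0 rho v.
case E: (Linfnorm rho v) => [r| |]//; rewrite lee_fin le_eqVlt => /predU1P[r0|r0] _.
  by case: vn0; apply: Linfnorm_eq0; rewrite E -r0.
by rewrite inver gt_eqF// lee_pdivrMr.
Qed.

(** Distributivity over the extended reals needs a nonnegative sampling norm,
    which a nonzero class provides: v itself, unless it vanishes almost
    everywhere, in which case both sides are 0. *)
Lemma L2norm_Mnorm_le_Linfnorm (K : R) v : (0 <= K)%R -> Linfty rho v ->
  L2norm rho v + K%:E * (Mnorm l v)%:E
  <= (1 + sampling_norm rho l * K%:E) * Linfnorm rho v.
Proof.
move=> K0 Lv; have L2 := L2norm_le_Linfnorm rho Lv.1.
have [v0|vn0] := pselect (v = (fun=> 0%R) %[ae rho]).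
  by move: L2; rewrite Linfnorm_ae0// Mnorm_ae0// !mule0 adde0.
have S0 : 0 <= sampling_norm rho l.
  apply: le_trans (sampling_norm_ubound Lv vn0).
  by apply: mule_ge0; rewrite ?inve_ge0 ?Linfnorm_ge0// lee_fin norm2_ge0.
rewrite ge0_muleDl ?mule_ge0// mul1e (muleC _ K%:E) -muleA.
by apply: leeD => //; apply: lee_wpmul2l => //; exact: Mnorm_le_Linfnorm.
Qed.

End sampling.

(** * Rounding errors and near-minimizers *)

Section approximation.
Context (R : realType) d (T : measurableType d) (rho : probability T R).
Context (n m : nat) (phi : 'I_n -> T -> R[i]) (l : 'I_m -> (T -> R[i]) -> R[i]).
Context (f : T -> R[i]).
Hypothesis phi_Linfty : forall i, Linfty rho (phi i).
Hypothesis l_linear : forall j, Linfty_linear rho (l j).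
Hypothesis f_Linfty : Linfty rho f.
Local Open Scope ereal_scope.

Lemma Linfty_residual c : Linfty rho (residual phi f c).
Proof. by apply: LinftyB => //; exact: Linfty_synthesis. Qed.

Lemma residualB c c' :
  synthesis phi (c - c') = (fun x => residual phi f c x - residual phi f c' x)%R.
Proof.
by rewrite synthesisB; apply/funext => x; rewrite /residual opprB addrA subrK.
Qed.

Lemma Mnorm_synthesisB c c' :
  (Mnorm l (synthesis phi (c - c')) <=
   Mnorm l (residual phi f c) + Mnorm l (residual phi f c'))%R.
Proof.
rewrite residualB /Mnorm (samplingB l_linear); [|exact: Linfty_residual..].
by rewrite (le_trans (norm2D _ _))// norm2N.
Qed.

Lemma L2norm_le_synthesis_norm i : L2norm rho (phi i) <= synthesis_norm rho phi.
Proof.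
apply: ereal_sup_ubound; exists (delta_mx i 0%R).
  apply/eqP => /matrixP /(_ i 0%R) /eqP.
  by rewrite !mxE !eqxx oner_eq0.
by rewrite norm2_delta inve1 mule1 synthesis_delta.
Qed.

(** For n = 0 the synthesis norm is a supremum over the empty set, namely -oo;
    the factor [Num.sqrt n%:R] then makes the product 0. *)
Lemma sqrt_mul_synthesis_norm_ge0 :
  0 <= (Num.sqrt n%:R)%:E * synthesis_norm rho phi.
Proof.
case: (posnP n) => [n0|n_gt0].
  by have -> : Num.sqrt n%:R = 0%R :> R; rewrite ?n0 ?sqrtr0// mul0e.
apply: mule_ge0; first by rewrite lee_fin sqrtr_ge0.
exact: le_trans (L2norm_ge0 rho _) (L2norm_le_synthesis_norm (Ordinal n_gt0)).
Qed.

Lemma sum_L2norm_le (c : 'cV[R[i]]_n) :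
  \sum_(i < n) (normc (c i ord0))%:E * L2norm rho (phi i)
  <= (Num.sqrt n%:R)%:E * synthesis_norm rho phi * (norm2 c)%:E.
Proof.
case: (posnP n) => [n0|n_gt0].
  rewrite big1 => [|i _]; last by have := leq_trans (ltn_ord i) (eq_leq n0).
  by rewrite mule_ge0 ?sqrt_mul_synthesis_norm_ge0// lee_fin norm2_ge0.
have S0 : 0 <= synthesis_norm rho phi.
  exact: le_trans (L2norm_ge0 rho _) (L2norm_le_synthesis_norm (Ordinal n_gt0)).
apply: (@le_trans _ _
    (\sum_(i < n) (normc (c i ord0))%:E * synthesis_norm rho phi)).
  apply: lee_sum => i _; apply: lee_wpmul2l; first by rewrite lee_fin normc_ge0.
  exact: L2norm_le_synthesis_norm.
rewrite -ge0_sume_distrl; last by move=> i _; rewrite lee_fin normc_ge0.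
rewrite muleAC; apply: lee_wpmul2r => //.
by rewrite sumEFin -EFinM lee_fin sum_normc_le.
Qed.

Section rounded.
Variables (u eps : R) (fl : R[i] -> R[i]).
Hypothesis u_ge0 : (0 <= u)%R.
Hypothesis fl_rounding : rounding u fl.
Hypothesis eps_ge : (u * Num.sqrt n%:R)%:E * synthesis_norm rho phi <= eps%:E.

Lemma rounding_eps_ge0 : (0 <= eps)%R.
Proof.
rewrite -lee_fin; apply: le_trans eps_ge; rewrite EFinM -muleA.
by rewrite mule_ge0 ?sqrt_mul_synthesis_norm_ge0.
Qed.

Lemma L2norm_rounding v : cmeasurable v ->
  L2norm rho (fun x => fl (v x) - v x)%R <= u%:E * L2norm rho v.
Proof.
move=> mv; apply: L2norm_le_scale => //.
  by apply: cmeasurableB => //; exact: rounding_cmeasurable fl_rounding mv.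
by move=> x; exact: rounding_error.
Qed.

(** The lower bound on [eps] is exactly what makes the regularisation term
    dominate the rounding of the functions [phi i]. *)
Lemma synthesis_rounding_error c :
  L2norm rho (fun x => synthesis (fun i => fl \o phi i) c x
                       - synthesis phi c x)%R
  <= (eps * norm2 c)%:E.
Proof.
have mphi i : cmeasurable (phi i) := (phi_Linfty i).1.
rewrite (_ : (fun x => _) =
    (fun x => \sum_(i < n) c i ord0 * (fl (phi i x) - phi i x)))%R; last first.
  apply/funext => x; rewrite /synthesis -sumrB.
  by apply: eq_bigr => i _; rewrite mulrBr.
apply: le_trans (L2norm_sum rho _ _ _) _.
  by move=> i; apply: cmeasurableB => //; exact: rounding_cmeasurable fl_rounding (mphi i).
apply: (@le_trans _ _
    (u%:E * \sum_(i < n) (normc (c i ord0))%:E * L2norm rho (phi i))).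
  rewrite ge0_sume_distrr; last first.
    by move=> i _; rewrite mule_ge0 ?L2norm_ge0// lee_fin normc_ge0.
  apply: lee_sum => i _; rewrite muleCA; apply: lee_wpmul2l.
    by rewrite lee_fin normc_ge0.
  exact: L2norm_rounding.
apply: le_trans (lee_wpmul2l _ (sum_L2norm_le c)) _; first by rewrite lee_fin.
rewrite EFinM !muleA -(EFinM u); apply: lee_wpmul2r => //.
by rewrite lee_fin norm2_ge0.
Qed.

(** The rounded residual is the exact one, plus the rounding error of the
    synthesis, minus that of f. *)
Lemma rounded_error c :
  L2norm rho (fun x => synthesis (fun i => fl \o phi i) c x - fl (f x))%R
  <= L2error rho phi f eps c + u%:E * L2norm rho f.
Proof.
have mphi i : cmeasurable (phi i) := (phi_Linfty i).1.
have mf := f_Linfty.1.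
have mflf : cmeasurable (fl \o f) by exact: rounding_cmeasurable fl_rounding mf.
have ms : cmeasurable (synthesis phi c) := (Linfty_synthesis c phi_Linfty).1.
have mfls : cmeasurable (synthesis (fun i => fl \o phi i) c).
  by apply: cmeasurable_sum => i; exact: rounding_cmeasurable fl_rounding (mphi i).
have mr := (Linfty_residual c).1.
rewrite (_ : (fun x => _) = (fun x => residual phi f c x +
    (synthesis (fun i => fl \o phi i) c x - synthesis phi c x
     - (fl (f x) - f x)))%R); last by apply/funext => x; rewrite /residual; ring.
have md := cmeasurableB mfls ms; have me := cmeasurableB mflf mf.
apply: le_trans (L2normD rho mr (cmeasurableB md me)) _.
rewrite /L2error -addeA; apply: leeD => //.
apply: le_trans (L2normB rho md me) _; apply: leeD; last exact: L2norm_rounding.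
exact: synthesis_rounding_error.
Qed.

End rounded.

Section near_minimizer.
Variables (gamma eps C : R) (hc : 'cV[R[i]]_n).
Hypothesis gamma_gt0 : (0 < gamma)%R.
Hypothesis eps_ge0 : (0 <= eps)%R.
Hypothesis norm_ineq : forall c : 'cV[R[i]]_n,
  gamma%:E * (L2norm rho (synthesis phi c) + (eps * norm2 c)%:E)
  <= (Mnorm l (synthesis phi c) + eps * norm2 c)%:E.
Hypothesis C_ge0 : (0 <= C)%R.
Hypothesis hc_near_opt : sampled_error phi l f eps hc
  <= C%:E * ereal_inf (range (sampled_error phi l f eps)).

(** The norm inequality is a stability estimate: it turns the closeness of the
    samples of T hc and T c, both near those of f, into closeness in L2. *)
Lemma L2error_near_minimizer c :
  L2error rho phi f eps hc <=
  L2error rho phi f eps c + ((1 + C) / gamma)%:E * sampled_error phi l f eps c.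
Proof.
have opt : sampled_error phi l f eps hc <= C%:E * sampled_error phi l f eps c.
  apply: le_trans hc_near_opt _; apply: lee_wpmul2l; first by rewrite lee_fin.
  by apply: ereal_inf_lbound; exists c.
have stable : L2norm rho (synthesis phi (hc - c)) + (eps * norm2 (hc - c))%:E
    <= ((1 + C) / gamma)%:E * sampled_error phi l f eps c.
  rewrite (mulrC (1 + C)%R) (EFinM gamma^-1) -muleA lee_pdivlMl//; apply: le_trans (norm_ineq _) _.
  rewrite -EFinM lee_fin; move: opt; rewrite -EFinM lee_fin.
  have := Mnorm_synthesisB hc c.
  have := ler_wpM2l eps_ge0 (norm2D hc (- c)); rewrite norm2N mulrDr.
  lra.
have Ehc : L2error rho phi f eps hc <=
    L2error rho phi f eps c +
    (L2norm rho (synthesis phi (hc - c)) + (eps * norm2 (hc - c))%:E).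
  rewrite /L2error addeACA -EFinD; apply: leeD; last first.
    by rewrite lee_fin -mulrDr ler_wpM2l// -{1}(subrKC c hc) norm2D.
  rewrite (_ : residual phi f hc =
      (fun x => residual phi f c x + synthesis phi (hc - c) x)%R).
    by apply: L2normD; [exact: (Linfty_residual c).1 |
                        exact: (Linfty_synthesis _ phi_Linfty).1].
  by apply/funext => x; rewrite residualB addrC subrK.
by apply: le_trans Ehc _; exact: leeD.
Qed.

End near_minimizer.

End approximation.

(** * The error of the computed approximation *)

Theorem theorem13 (R : realType) (d : nat) (X : set (d.-tuple R))
    (mX : measurable X) (X0 : X !=set0)
    (rho : probability (submeasurable X0) R) (rho_na : nonatomic rho)
    (n m : nat)
    (phi : 'I_n -> submeasurable X0 -> R[i])
    (phi_Linfty : forall i, Linfty rho (phi i))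
    (l : 'I_m -> (submeasurable X0 -> R[i]) -> R[i])
    (l_linear : forall j, Linfty_linear rho (l j))
    (l_bounded : (sampling_norm rho l < +oo)%E)
    (u : R) (u_gt0 : 0 < u) (fl : R[i] -> R[i]) (fl_rounding : rounding u fl)
    (gamma eps C : R) (gamma_gt0 : 0 < gamma) (gamma_le1 : gamma <= 1)
    (eps_ge : ((u * Num.sqrt n%:R)%:E * synthesis_norm rho phi <= eps%:E)%E)
    (norm_ineq : forall c : 'cV[R[i]]_n,
      (gamma%:E * (L2norm rho (synthesis phi c) + (eps * norm2 c)%:E)
       <= (Mnorm l (synthesis phi c) + eps * norm2 c)%:E)%E)
    (f : submeasurable X0 -> R[i]) (f_Linfty : Linfty rho f)
    (C_ge1 : 1 <= C) (hc : 'cV[R[i]]_n)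
    (hc_near_opt : (sampled_error phi l f eps hc
       <= C%:E * ereal_inf (range (sampled_error phi l f eps)))%E) :
  (L2norm rho
     (fun x => (synthesis (fun i => fl \o phi i) hc x - fl (f x))%R)
   <= ereal_inf (range (fun c : 'cV[R[i]]_n =>
        L2error rho phi f eps c
        + ((1 + C) / gamma)%:E * sampled_error phi l f eps c))
      + u%:E * L2norm rho f)%E
  /\
  (ereal_inf (range (fun c : 'cV[R[i]]_n =>
        L2error rho phi f eps c
        + ((1 + C) / gamma)%:E * sampled_error phi l f eps c))
      + u%:E * L2norm rho f
   <= ereal_inf (range (fun c : 'cV[R[i]]_n =>
        (1%:E + sampling_norm rho l * ((1 + C) / gamma)%:E)
          * Linfnorm rho (residual phi f c)
        + ((1 + (1 + C) / gamma) * (eps * norm2 c))%:E))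
      + u%:E * L2norm rho f)%E.
Proof.
have u_ge0 := ltW u_gt0; have C_ge0 := le_trans ler01 C_ge1.
have eps_ge0 := rounding_eps_ge0 u_ge0 eps_ge.
split.
  apply: le_trans (rounded_error phi_Linfty f_Linfty u_ge0 fl_rounding eps_ge hc) _.
  apply: leeD => //; apply: le_ereal_inf_tmp => _ [c _ <-].
  exact: (L2error_near_minimizer phi_Linfty l_linear f_Linfty gamma_gt0 eps_ge0
            norm_ineq C_ge0 hc_near_opt).
apply: leeD => //; apply: le_ereal_inf_tmp => _ [c _ <-].
apply: le_trans (ereal_inf_lbound (imageT _ c)) _.
set K := ((1 + C) / gamma)%R.
have K_ge0 : (0 <= K)%R by rewrite divr_ge0 ?addr_ge0// ltW.
(* regroup the sum as two error terms followed by two regularisation terms *)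
rewrite /L2error /sampled_error EFinD muleDr// addeACA -EFinM -EFinM -EFinD.
apply: leeD; last by rewrite lee_fin mulrDl mul1r.
rewrite EFinM; apply: (L2norm_Mnorm_le_Linfnorm l_linear) => //.
exact: Linfty_residual.
Qed.
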